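(* Let $(A,\dashv_A,\vdash_A)$ be a diassociative algebra and let $(V,\ell_{\dashv},r_{\dashv},\ell_{\vdash},r_{\vdash})$ be a representation of $(A,\dashv_A,\vdash_A)$. Let $\hat A:=A\oplus V^*$ be the semi-direct product diassociative algebra of $A$ with the representation $(V^*,\ r^*_{\dashv}-r^*_{\vdash},\ \ell^*_{\vdash},\ r^*_{\dashv},\ \ell^*_{\vdash}-\ell^*_{\dashv})$. Let $T:V\to A$ be a linear map, identified with an element $T\in V^*\otimes A\subset\hat A\otimes\hat A$. Then $r:=T+\sigma(T)$ is a symmetric solution of the diassociative Yang-Baxter equation (DYBE) in $\hat A$ if and only if $T$ is an $\mathcal{O}$-operator of $(A,\dashv_A,\vdash_A)$ associated to $(V,\ell_{\dashv},r_{\dashv},\ell_{\vdash},r_{\vdash})$.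
   Context: All vector spaces are finite-dimensional over a field $\mathbf{k}$ of characteristic $0$. A diassociative algebra is a triple $(A,\dashv_A,\vdash_A)$ consisting of a vector space $A$ and two bilinear operations such that for all $x,y,z\in A$ (subscripts omitted): $(x\dashv y)\dashv z=x\dashv(y\dashv z)=x\dashv(y\vdash z)$; $(x\vdash y)\dashv z=x\vdash(y\dashv z)$; $(x\vdash y)\vdash z=(x\dashv y)\vdash z=x\vdash(y\vdash z)$. Put $x\bullet_A y:=x\vdash_A y-x\dashv_A y$. A representation of $(A,\dashv_A,\vdash_A)$ is a tuple $(V,\ell_{\dashv},r_{\dashv},\ell_{\vdash},r_{\vdash})$ of a vector space $V$ and linear maps $A\to\mathrm{End}(V)$ such that $A\oplus V$ with $(a+u)\dashv'(b+v)=a\dashv_A b+\ell_{\dashv}(a)v+r_{\dashv}(b)u$, $(a+u)\vdash'(b+v)=a\vdash_A b+\ell_{\vdash}(a)v+r_{\vdash}(b)u$ is a diassociative algebra, which is then called the semi-direct product diassociative algebra. For $\rho:A\to\mathrm{End}(V)$, $\rho^*:A\to\mathrm{End}(V^* )$ is the transpose: $\langle\rho^*(x)u^*,v\rangle=\langle u^*,\rho(x)v\rangle$ (no sign). If $(V,\ell_{\dashv},r_{\dashv},\ell_{\vdash},r_{\vdash})$ is a representation then so is $(V^*,r^*_{\dashv}-r^*_{\vdash},\ell^*_{\vdash},r^*_{\dashv},\ell^*_{\vdash}-\ell^*_{\dashv})$. A linear map $T:V\to A$ is an $\mathcal{O}$-operator of $(A,\dashv_A,\vdash_A)$ associated to $(V,\ell_{\dashv},r_{\dashv},\ell_{\vdash},r_{\vdash})$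 if for all $u,v\in V$: $T(u)\dashv_A T(v)=T(\ell_{\dashv}(T(u))v+r_{\dashv}(T(v))u)$ and $T(u)\vdash_A T(v)=T(\ell_{\vdash}(T(u))v+r_{\vdash}(T(v))u)$. Identification: for a basis $\{e_i\}$ of $V$ with dual basis $\{e_i^*\}$, $T$ corresponds to $\sum_i e_i^*\otimes T(e_i)$. $\sigma(u\otimes v)=v\otimes u$; $r$ is symmetric if $\sigma(r)=r$. An element $r=\sum_i u_i\otimes v_i\in A\otimes A$ is a solution of the DYBE in a diassociative algebra $(A,\dashv_A,\vdash_A)$ if $\sum_{i,j}\big(u_i\vdash_A u_j\otimes v_i\otimes v_j-u_i\otimes u_j\otimes v_i\dashv_A v_j-u_i\otimes u_j\bullet_A v_i\otimes v_j\big)=0$ in $A\otimes A\otimes A$. *)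

(* Defs.v *)
From HB Require Import structures.
From mathcomp Require Import all_boot all_order all_algebra.

Set Implicit Arguments.
Unset Strict Implicit.
Unset Printing Implicit Defensive.

Import GRing.Theory VectorInternalTheory.
Local Open Scope ring_scope.

Definition dual (k : fieldType) (V : vectType k) : vectType k := 'Hom(V, k^o).

Section Tensor.
Variable k : fieldType.

(* A tensor is its matrix of coordinates with respect to the library's
   coordinate maps v2r; tens_universal is the universal property, so the
   choice of coordinates is immaterial. *)
Definition tens (A B : vectType k) : vectType k := 'M[k]_(dim A, dim B).

Definition tpure (A B : vectType k) (a : A) (b : B) : tens A B :=
  (v2r a)^T *m v2r b.

Lemma tpure_bilinear (A B : vectType k) :
  bilinear_for *:%R *:%R (@tpure A B).
Proof.
split=> [b|a] c x y; rewrite /tpure.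
  by rewrite !linearP /= mulmxDl scalemxAl.
by rewrite !linearP.
Qed.

HB.instance Definition _ (A B : vectType k) :=
  bilinear_isBilinear.Build k A B (tens A B) *:%R *:%R (@tpure A B)
    (tpure_bilinear A B).

Definition tswap (A B : vectType k) (t : tens A B) : tens B A :=
  (t : 'M_(_, _))^T.

Lemma tswapE (A B : vectType k) (a : A) (b : B) :
  tswap (tpure a b) = tpure b a.
Proof. by rewrite /tswap /tpure trmx_mul trmxK. Qed.

Definition tsum (A B : vectType k) (s : seq (A * B)) : tens A B :=
  \sum_(p <- s) tpure p.1 p.2.

Definition tlift (A B C : vectType k) (f : A -> B -> C) (t : tens A B) : C :=
  \sum_i \sum_j (t : 'M_(_, _)) i j *: f (r2v (delta_mx 0 i)) (r2v (delta_mx 0 j)).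

Lemma tlift_linear (A B C : vectType k) (f : A -> B -> C) : linear (tlift f).
Proof.
move=> c s t; rewrite /tlift scaler_sumr -big_split; apply: eq_bigr => i _ /=.
rewrite scaler_sumr -big_split; apply: eq_bigr => j _ /=.
by rewrite !mxE scalerDl scalerA.
Qed.

HB.instance Definition _ (A B C : vectType k) (f : A -> B -> C) :=
  GRing.isLinear.Build k (tens A B) C *:%R (tlift f) (tlift_linear f).

Lemma v2r_decomp (A : vectType k) (a : A) :
  a = \sum_i v2r a 0 i *: r2v (delta_mx 0 i).
Proof.
rewrite -{1}[a]v2rK {1}[v2r a]row_sum_delta linear_sum.
by apply: eq_bigr => i _; rewrite linearZ.
Qed.

Lemma tlift_pure (A B C : vectType k) (f : {bilinear A -> B -> C}) a b :
  tlift f (tpure a b) = f a b.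
Proof.
rewrite {2}[a]v2r_decomp linear_sumlz /tlift; apply: eq_bigr => i _.
rewrite linearZl_LR {2}[b]v2r_decomp linear_sumr scaler_sumr.
apply: eq_bigr => j _; rewrite linearZr scalerA; congr (_ *: _).
by rewrite /tpure mxE big_ord1 mxE.
Qed.

Lemma tens_decomp (A B : vectType k) (t : tens A B) : exists s, t = tsum s.
Proof.
exists [seq (t p.1 p.2 *: r2v (delta_mx 0 p.1), r2v (delta_mx 0 p.2))
       | p : 'I_(dim A) * 'I_(dim B)].
rewrite /tsum big_map big_enum /= -(pair_bigA _ (fun i j =>
  tpure (t i j *: r2v (delta_mx 0 i)) (r2v (delta_mx 0 j)))) /=.
rewrite {1}[t]matrix_sum_delta; apply: eq_bigr => i _; apply: eq_bigr => j _.
rewrite linearZl_LR /= /tpure !r2vK; congr (_ *: _).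
by rewrite trmx_delta mul_delta_mx.
Qed.

Lemma tens_universal (A B C : vectType k) (f : {bilinear A -> B -> C}) :
  exists! g : 'Hom(tens A B, C), forall a b, g (tpure a b) = f a b.
Proof.
exists (linfun (tlift f)); split=> [a b|g gE].
  by rewrite lfunE /= tlift_pure.
apply/lfunP=> t; have [s ->] := tens_decomp t.
rewrite /tsum !linear_sum; apply: eq_bigr => p _.
by rewrite /= lfunE /= tlift_pure gE.
Qed.

Lemma tsum_eq (A B C : vectType k) (f : A -> B -> C) (s t : seq (A * B)) :
  bilinear_for *:%R *:%R f -> tsum s = tsum t ->
  \sum_(p <- s) f p.1 p.2 = \sum_(p <- t) f p.1 p.2.
Proof.
move=> fP; pose g : {bilinear A -> B -> C} :=
  HB.pack f (bilinear_isBilinear.Build _ _ _ _ _ _ _ fP).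
have [h [hE _]] := tens_universal g.
have E u : \sum_(p <- u) f p.1 p.2 = h (tsum u).
  by rewrite linear_sum; apply: eq_bigr => p _; rewrite /= hE.
by move=> st; rewrite !E st.
Qed.

End Tensor.

Section Diassociative.
Variable k : fieldType.

(* dl and dr are the operations \dashv and \vdash. *)
Definition diassociative (U : Type) (dl dr : U -> U -> U) : Prop :=
  forall x y z : U,
  [/\ dl (dl x y) z = dl x (dl y z),
      dl x (dl y z) = dl x (dr y z),
      dl (dr x y) z = dr x (dl y z),
      dr (dr x y) z = dr (dl x y) z &
      dr (dl x y) z = dr x (dr y z)].

Record diass_alg (A : vectType k) := DiassAlg {
  dashv : {bilinear A -> A -> A};
  vdash : {bilinear A -> A -> A};
  diassP : diassociative dashv vdash
}.

Definition bullet (A : vectType k) (D : diass_alg A) (x y : A) : A :=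
  vdash D x y - dashv D x y.

Fact bullet_bilinear (A : vectType k) (D : diass_alg A) :
  bilinear_for *:%R *:%R (bullet D).
Proof.
split=> [b|a] c x y; rewrite /bullet.
  by rewrite 2!linearPl /= [in RHS]scalerBr opprD addrACA.
by rewrite 2!linearPr /= [in RHS]scalerBr opprD addrACA.
Qed.

HB.instance Definition _ (A : vectType k) (D : diass_alg A) :=
  bilinear_isBilinear.Build k A A A *:%R *:%R (bullet D) (bullet_bilinear D).

(* x = a + u and y = b + v are the pairs (a, u) and (b, v). *)
Definition sd_op (A V : vectType k) (op : A -> A -> A)
    (l r : {linear A -> 'End(V)}) (x y : A * V) : A * V :=
  (op x.1 y.1, l x.1 y.2 + r y.1 x.2).

Fact sd_op_bilinear (A V : vectType k) (op : {bilinear A -> A -> A})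
    (l r : {linear A -> 'End(V)}) :
  bilinear_for *:%R *:%R (sd_op op l r).
Proof.
split=> [[b v]|[a u]] c [x w] [y z]; rewrite /sd_op /=; congr (_, _).
- by rewrite linearPl.
- rewrite !linearP /= !lfun_simp scalerDr -!addrA; congr (_ + _).
  by rewrite addrCA.
- by rewrite linearPr.
- rewrite !linearP /= !lfun_simp scalerDr -!addrA; congr (_ + _).
  by rewrite addrCA.
Qed.

HB.instance Definition _ (A V : vectType k) (op : {bilinear A -> A -> A})
    (l r : {linear A -> 'End(V)}) :=
  bilinear_isBilinear.Build k (A * V)%type (A * V)%type (A * V)%type
    *:%R *:%R (sd_op op l r) (sd_op_bilinear op l r).

Lemma sd_diassociativeP (A V : vectType k) (D : diass_alg A)
    (l r L R : {linear A -> 'End(V)}) :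
  diassociative (sd_op (dashv D) l r) (sd_op (vdash D) L R) <->
  forall (x y : A) (v : V),
  [/\ [/\ l (dashv D x y) v = l x (l y v),
          l x (l y v) = l x (L y v),
          l (vdash D x y) v = L x (l y v),
          L (vdash D x y) v = L (dashv D x y) v &
          L (dashv D x y) v = L x (L y v)],
      [/\ r y (l x v) = l x (r y v),
          l x (r y v) = l x (R y v),
          r y (L x v) = L x (r y v),
          R y (L x v) = R y (l x v) &
          R y (l x v) = L x (R y v)] &
      [/\ r y (r x v) = r (dashv D x y) v,
          r (dashv D x y) v = r (vdash D x y) v,
          r y (R x v) = R (dashv D x y) v,
          R y (R x v) = R y (r x v) &
          R y (r x v) = R (vdash D x y) v]].
Proof.
split=> [H x y v | H [x u] [y v] [z w]].
  have S (p q : A * V) : p = q -> p.2 = q.2 by move=> ->.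
  have E f : (f : 'End(V)) 0 = 0 by rewrite linear0.
  have := H (x, 0) (y, 0) (0, v).
  rewrite /sd_op /= => -[/S H1 /S H2 /S H3 /S H4 /S H5].
  have := H (x, 0) (0, v) (y, 0).
  rewrite /sd_op /= => -[/S H6 /S H7 /S H8 /S H9 /S H10].
  have := H (0, v) (x, 0) (y, 0).
  rewrite /sd_op /= => -[/S H11 /S H12 /S H13 /S H14 /S H15].
  move: H1 H2 H3 H4 H5 H6 H7 H8 H9 H10 H11 H12 H13 H14 H15 => /=.
  by rewrite !(E, addr0, add0r); do 15!move=> ?; split; split.
have [D1 D2 D3 D4 D5] := diassP D x y z.
have [[a1 a2 a3 a4 a5] _ _] := H x y w.
have [_ [b1 b2 b3 b4 b5] _] := H x z v.
have [_ _ [c1 c2 c3 c4 c5]] := H y z u.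
rewrite /sd_op /=; split; congr (_, _) => //; rewrite !linearD /= -?addrA.
- by rewrite a1 b1 c1.
- by rewrite a2 b2 c2.
- by rewrite a3 b3 c3.
- by rewrite a4 b4 c4.
- by rewrite a5 b5 c5.
Qed.

Record diass_rep (A : vectType k) (D : diass_alg A) (V : vectType k) :=
  DiassRep {
  l_dashv : {linear A -> 'End(V)};
  r_dashv : {linear A -> 'End(V)};
  l_vdash : {linear A -> 'End(V)};
  r_vdash : {linear A -> 'End(V)};
  diass_repP : diassociative (sd_op (dashv D) l_dashv r_dashv)
                             (sd_op (vdash D) l_vdash r_vdash)
}.

Definition semidirect (A V : vectType k) (D : diass_alg A)
    (M : diass_rep D V) : diass_alg (A * V)%type :=
  DiassAlg (dashv := sd_op (dashv D) (l_dashv M) (r_dashv M))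
           (vdash := sd_op (vdash D) (l_vdash M) (r_vdash M)) (diass_repP M).

Definition O_operator (A V : vectType k) (D : diass_alg A)
    (M : diass_rep D V) (T : 'Hom(V, A)) : Prop :=
  forall u v : V,
  dashv D (T u) (T v) = T (l_dashv M (T u) v + r_dashv M (T v) u) /\
  vdash D (T u) (T v) = T (l_vdash M (T u) v + r_vdash M (T v) u).

End Diassociative.

Section DualRep.
Variables (k : fieldType) (A V : vectType k).

Definition tr_fun (f : 'End(V)) (xi : dual V) : dual V := (xi \o f)%VF.

Fact tr_fun_linear f : linear (tr_fun f).
Proof.
by move=> c xi eta; apply/lfunP=> v; rewrite /tr_fun !lfun_simp.
Qed.

HB.instance Definition _ f :=
  GRing.isLinear.Build k (dual V) (dual V) *:%R (tr_fun f) (tr_fun_linear f).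

(* No sign: this is the plain transpose. *)
Definition transpose (f : 'End(V)) : 'End(dual V) := linfun (tr_fun f).

Lemma transposeE f (xi : dual V) v : transpose f xi v = xi (f v).
Proof. by rewrite lfunE /= /tr_fun comp_lfunE. Qed.

Definition dual_map (rho : {linear A -> 'End(V)}) (x : A) : 'End(dual V) :=
  transpose (rho x).

Fact dual_map_linear rho : linear (dual_map rho).
Proof.
move=> c x y; apply/lfunP=> xi; apply/lfunP=> v.
by rewrite /dual_map linearP !(transposeE, lfun_simp) linearP.
Qed.

HB.instance Definition _ rho :=
  GRing.isLinear.Build k A 'End(dual V) *:%R (dual_map rho)
    (dual_map_linear rho).

Lemma dual_mapE rho x (xi : dual V) v : dual_map rho x xi v = xi (rho x v).
Proof. exact: transposeE. Qed.

Variables (D : diass_alg A) (M : diass_rep D V).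

Fact dual_repP :
  diassociative
    (sd_op (dashv D) (dual_map (r_dashv M) \- dual_map (r_vdash M))
                     (dual_map (l_vdash M)))
    (sd_op (vdash D) (dual_map (r_dashv M))
                     (dual_map (l_vdash M) \- dual_map (l_dashv M))).
Proof.
have H := (sd_diassociativeP _ _ _ _ _).1 (diass_repP M).
apply/sd_diassociativeP => x y xi.
have E := (dual_mapE, lfun_simp).
split; split; apply/lfunP => v; rewrite !E;
  have [[a1 a2 a3 a4 a5] _ [c1 c2 c3 c4 c5]] := H x y v;
  have [_ [e1 e2 e3 e4 e5] _] := H y x v.
all: by rewrite ?(a1, a2, a3, a4, a5) ?(c1, c3, c4, c5) ?c2
                ?(e1, e2, e3, e4, e5) // opprB ?subrKA.
Qed.

Definition dual_rep : diass_rep D (dual V) := DiassRep dual_repP.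

End DualRep.

Section DYBE.
Variables (k : fieldType) (A : vectType k) (D : diass_alg A).

Local Notation AA := (tens A A).
Local Notation AAA := (tens AA A).
Local Notation "a ** b" := (tpure a b) (at level 38, left associativity).

Definition dybe_expr (s : seq (A * A)) : AAA :=
  \sum_(p <- s) \sum_(q <- s)
    (vdash D p.1 q.1 ** p.2 ** q.2
     - p.1 ** q.1 ** dashv D p.2 q.2
     - p.1 ** bullet D q.1 p.2 ** q.2).

(* The expression depends only on r (dybe_expr_eq), and every r has a
   decomposition (tens_decomp): one may as well say "for some s". *)
Definition dybe_solution (r : AA) : Prop :=
  forall s, r = tsum s -> dybe_expr s = 0.

Definition tsymmetric (r : AA) : Prop := tswap r = r.

Lemma dybe_expr_eq s t : tsum s = tsum t -> dybe_expr s = dybe_expr t.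
Proof.
pose F (p q : A * A) : AAA :=
  vdash D p.1 q.1 ** p.2 ** q.2 - p.1 ** q.1 ** dashv D p.2 q.2
  - p.1 ** bullet D q.1 p.2 ** q.2.
have comb c (X1 X2 X3 Y1 Y2 Y3 : AAA) :
    (c *: X1 + Y1) - (c *: X2 + Y2) - (c *: X3 + Y3) =
    c *: (X1 - X2 - X3) + (Y1 - Y2 - Y3).
  by rewrite !scalerBr !opprD [RHS]addrACA; congr (_ + _); rewrite addrACA.
have Fl q : bilinear_for *:%R *:%R (fun a b => F (a, b) q).
  split=> [b|a] c x y; rewrite /F /= -comb.
    by rewrite !linearPl.
  by rewrite !(linearPl, linearPr).
have Fr p : bilinear_for *:%R *:%R (fun a b => F p (a, b)).
  by split=> [b|a] c x y; rewrite /F /= -comb !(linearPl, linearPr).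
have FE u p : \sum_(q <- u) F p q = \sum_(q <- u) F p (q.1, q.2).
  by apply: eq_bigr => -[].
move=> st; rewrite /dybe_expr -/F.
transitivity (\sum_(p <- s) \sum_(q <- t) F p q).
  by apply: eq_bigr => p _; rewrite !FE; apply: (tsum_eq (Fr p)).
rewrite exchange_big [RHS]exchange_big /=; apply: eq_bigr => q _.
have FE' u : \sum_(p <- u) F p q = \sum_(p <- u) F (p.1, p.2) q.
  by apply: eq_bigr => -[].
by rewrite !FE'; apply: (tsum_eq (Fl q)).
Qed.

Lemma dybe_solutionP (r : AA) :
  dybe_solution r <-> exists2 s, r = tsum s & dybe_expr s = 0.
Proof.
split=> [sol|[s -> s0] t /dybe_expr_eq <- //].
by have [s rE] := tens_decomp r; exists s => //; apply: sol.
Qed.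

End DYBE.

Section HomTensor.
Variables (k : fieldType) (A V : vectType k).
Local Notation hatA := (A * dual V)%type.

Definition dual_basis n (e : n.-tuple V) (i : 'I_n) : dual V :=
  linfun (coord e i : V -> k^o).

(* The image in hatA (x) hatA of the tensor \sum_i e_i^* (x) T e_i; it does not
   depend on the basis e, see hom_tens_basis. *)
Definition hom_tens_of n (e : n.-tuple V) (T : 'Hom(V, A)) :
    tens hatA hatA :=
  \sum_(i < n) tpure (0, dual_basis e i) (T e`_i, 0).

Definition hom_tens (T : 'Hom(V, A)) := hom_tens_of (vbasis {:V}) T.

Lemma hom_tens_basis n (e : n.-tuple V) (T : 'Hom(V, A)) :
  basis_of {:V} e -> hom_tens T = hom_tens_of e T.
Proof.
move=> eB; rewrite /hom_tens; move: (vbasisP {:V}).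
move: (vbasis _); move: (\dim _) => m e' e'B; rewrite /hom_tens_of.
pose f (xi : dual V) (a : A) : tens hatA hatA := tpure (0, xi) (a, 0).
have fP : bilinear_for *:%R *:%R f.
  split=> [b|xi] c x y; rewrite /f.
    have -> : (0, c *: x + y) = c *: (0, x) + (0, y) :> hatA.
      by congr (_, _); rewrite /= scaler0 addr0.
    by rewrite linearPl.
  have -> : (c *: x + y, 0) = c *: (x, 0) + (y, 0) :> hatA.
    by congr (_, _); rewrite /= scaler0 addr0.
  by rewrite linearPr.
have [g gE] : exists g : {bilinear dual V -> A -> tens hatA hatA},
    forall xi a, tpure (0, xi) (a, 0) = g xi a.
  pose g : {bilinear dual V -> A -> tens hatA hatA} :=
    HB.pack f (bilinear_isBilinear.Build _ _ _ _ _ _ _ fP).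
  by exists g.
under eq_bigr do rewrite gE.
under [RHS]eq_bigr do rewrite gE.
have xiE i : dual_basis e' i = \sum_(j < n) coord e' i e`_j *: dual_basis e j.
  apply/lfunP => v; rewrite sum_lfunE lfunE /=.
  rewrite {1}(coord_basis eB (memvf v)) linear_sum; apply: eq_bigr => j _.
  by rewrite scale_lfunE lfunE /= linearZ /= mulrC.
under eq_bigr => i _ do rewrite xiE linear_sumlz.
rewrite exchange_big; apply: eq_bigr => j _ /=.
rewrite [in RHS](coord_basis e'B (memvf e`_j)) !linear_sum.
apply: eq_bigr => i _ /=; rewrite linearZl_LR linearZ /= linearZr; congr (_ *: _).
Qed.
End HomTensor.

(* Main.v *)
(** Contracting a symmetric [r] with a functional [f] gives a map
    [r# : dual -> algebra], and the DYBE, evaluated on [f (x) g (x) h], reads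
    [f (r# g |- r# h) = h (r# f -| r# g) + g (r# h . r# f)], where [.] is the
    bullet product.  A functional on [A (+) V^*] is a pair [(a, u)] with
    [a : A^*] and [u : V], and for [r = T + sigma T] one has
    [r# (a, u) = (T u, a \o T)].  With [L] and [R] the failures of the
    O-operator identities for [-|] and [|-], the DYBE becomes
    [a (R v w) - c (L u v) - b (R w u - L w u) = 0] for all [(a, u)], [(b, v)],
    [(c, w)], and taking [b = 0] together with [a = 0] or [c = 0] isolates [L] and [R]. *)
From HB Require Import structures.
Require Import Defs.
From mathcomp Require Import all_boot all_order all_algebra.
From mathcomp Require Import ring.

Import GRing.Theory VectorInternalTheory.
Local Open Scope ring_scope.

Set Implicit Arguments.
Unset Strict Implicit.

(** * Contraction of a tensor by functionals *)

Section Contraction.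
Context {k : fieldType} {A B : vectType k}.

(** This is the map [r#] when [r] is symmetric. It pairs the right factor, so on a triple tensor
    [a (contract b (contract c t))] is the value of [t] on [a (x) b (x) c]. *)
Definition contract (g : dual B) : 'Hom(tens A B, A) :=
  linfun (tlift (fun a b => (g b : k) *: a)).

Lemma contract_tpure g a b : contract g (tpure a b) = (g b : k) *: a.
Proof.
have fP : bilinear_for *:%R *:%R (fun (a : A) (b : B) => (g b : k) *: a).
  split=> [b'|a'] c x y /=; first by rewrite scalerDr !scalerA mulrC.
  by rewrite linearP scalerDl scalerA.
pose f : {bilinear A -> B -> A} :=
  HB.pack (fun (a : A) (b : B) => (g b : k) *: a)
    (bilinear_isBilinear.Build _ _ _ _ _ _ _ fP).
by rewrite lfunE; exact: (tlift_pure f).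
Qed.

Lemma contract_tsum g s :
  contract g (tsum s) = \sum_(p <- s) (g p.2 : k) *: p.1.
Proof.
by rewrite /tsum linear_sum; apply: eq_bigr => p _; rewrite /= contract_tpure.
Qed.

End Contraction.

Lemma v2r_functional {k : fieldType} {A : vectType k} (i : 'I_(dim A)) :
  exists f : dual A, forall x, f x = v2r x 0 i.
Proof.
pose c (y : A) : k^o := v2r y 0 i.
have cP : linear c by move=> t y z; rewrite /c linearP !mxE.
pose c' : {linear A -> k^o} := HB.pack c (GRing.isLinear.Build _ _ _ _ c cP).
by exists (linfun c') => x; rewrite lfunE.
Qed.

Lemma dual_separates {k : fieldType} {A : vectType k} (x : A) :
  (forall a : dual A, a x = 0) -> x = 0.
Proof.
move=> x0; rewrite (v2r_decomp x) big1 // => i _.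
by have [f fE] := v2r_functional i; rewrite -fE x0 scale0r.
Qed.

(** Contracting with the [j]-th coordinate functional of [B] returns column [j] of the coordinate
    matrix. *)
Lemma contract_eq0 {k : fieldType} {A B : vectType k} (t : tens A B) :
  (forall g : dual B, contract g t = 0) -> t = 0.
Proof.
move=> t0; apply/matrixP => i j; rewrite mxE.
have [f fE] := v2r_functional j; have [s tE] := tens_decomp t.
have := t0 f; rewrite tE contract_tsum => /(congr1 v2r).
rewrite linear0 linear_sum /= => /matrixP/(_ 0 i); rewrite [in RHS]mxE => t0'.
rewrite -[RHS]t0' /tsum !summxE; apply: eq_bigr => p _.
by rewrite linearZ fE !mxE big_ord1 !mxE mulrC.
Qed.

Lemma contract_tswap {k : fieldType} {A : vectType k} g (s : seq (A * A)) :
  contract g (tswap (tsum s)) = \sum_(p <- s) (g p.1 : k) *: p.2.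
Proof.
rewrite /tsum /tswap raddf_sum linear_sum; apply: eq_bigr => p _ /=.
by rewrite -[X in contract _ X]/(tswap _) tswapE contract_tpure.
Qed.

(** * The DYBE for symmetric [r], tested on functionals *)

Lemma functional_bilinear_sum {k : fieldType} {A : vectType k} (a : dual A)
    (f : {bilinear A -> A -> A}) I J (s : seq I) (t : seq J)
    (x : I -> k) (u : I -> A) (y : J -> k) (v : J -> A) :
  a (f (\sum_(p <- s) x p *: u p) (\sum_(q <- t) y q *: v q)) =
  \sum_(p <- s) \sum_(q <- t) x p * y q * (a (f (u p) (v q)) : k).
Proof.
rewrite linear_sumlz linear_sum; apply: eq_bigr => p _.
rewrite linearZl_LR linear_sumr linearZ linear_sum [LHS]scaler_sumr.
by apply: eq_bigr => q _; rewrite linearZr linearZ -mulrA.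
Qed.

Lemma dybe_exprE {k : fieldType} {A : vectType k} (D : diass_alg A) s
    (a b c : dual A) (r := tsum s) :
  tsymmetric r ->
  a (contract b (contract c (dybe_expr D s))) =
  a (vdash D (contract b r) (contract c r))
  - c (dashv D (contract a r) (contract b r))
  - b (bullet D (contract c r) (contract a r)).
Proof.
move=> rS; rewrite /r.
have swE g : contract g r = \sum_(p <- s) (g p.1 : k) *: p.2.
  by rewrite -rS contract_tswap.
(* In the second term [a] and [b] meet left legs of [r], and in the third [a] does; symmetry is
   needed for exactly these three contractions. The sums of the third term are then exchanged
   because its leg from [q] comes first in the bullet product. *)
rewrite [X in dashv D X _]swE [X in dashv D _ X]swE [X in bullet D _ X]swE.
rewrite !contract_tsum !functional_bilinear_sum [in X in _ - X]exchange_big /=.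
pose phi := (a \o contract b \o contract c)%VF.
have phiE x y z :
    phi (tpure (tpure x y) z) = (c z : k) * ((b y : k) * (a x : k)).
  by rewrite !comp_lfunE contract_tpure linearZ /= contract_tpure !linearZ.
transitivity (phi (dybe_expr D s)); first by rewrite !comp_lfunE.
rewrite -!sumrB linear_sum; apply: eq_bigr => p _ /=.
rewrite -!sumrB linear_sum; apply: eq_bigr => q _ /=.
rewrite 2![in LHS]linearB /= !phiE; congr (_ - _ - _).
- by rewrite mulrCA mulrA.
- by rewrite mulrC [X in X * _]mulrC.
- by rewrite [X in _ * X]mulrC mulrA.
Qed.

Lemma dybe_solution_symP {k : fieldType} {A : vectType k} (D : diass_alg A)
    (r : tens A A) :
  tsymmetric r ->
  dybe_solution D r <-> forall a b c : dual A,
    a (vdash D (contract b r) (contract c r))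
    - c (dashv D (contract a r) (contract b r))
    - b (bullet D (contract c r) (contract a r)) = 0.
Proof.
have [s ->] := tens_decomp r => rS.
split=> [sol a b c | H t rE].
  by rewrite -dybe_exprE // sol // !linear0.
apply: contract_eq0 => c; apply: contract_eq0 => b; apply: dual_separates => a.
by rewrite dybe_exprE -?rE //.
Qed.

(** * Functionals on [hatA] and their contractions with [T + sigma T] *)

Section HomTens.
Context {k : fieldType} {A V : vectType k}.
Local Notation hatA := (A * dual V)%type.

Lemma dual_basis_decomp (xi : dual V) :
  xi = \sum_(i < \dim {:V})
    (xi (vbasis {:V})`_i : k) *: dual_basis (vbasis {:V}) i.
Proof.
apply/lfunP => v; rewrite {1}(coord_vbasis (memvf v)) linear_sum sum_lfunE.
apply: eq_bigr => i _; rewrite linearZ scale_lfunE [dual_basis _ _ _]lfunE.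
exact: mulrC.
Qed.

Lemma pair_suml (I : finType) (x : I -> A) :
  \sum_i (x i, 0) = (\sum_i x i, 0) :> hatA.
Proof.
by elim/big_rec2: _ => // i y1 y2 _ ->; congr (_, _); rewrite /= addr0.
Qed.

Lemma pair_sumr (I : finType) (xi : I -> dual V) :
  \sum_i (0, xi i) = (0, \sum_i xi i) :> hatA.
Proof.
by elim/big_rec2: _ => // i y1 y2 _ ->; congr (_, _); rewrite /= addr0.
Qed.

(** This is the identification of [V] with its double dual: [v] is rebuilt from the values of [f] on
    the dual basis. *)
Lemma functional_hatE (f : dual hatA) :
  exists (a : dual A) (v : V), forall x xi, f (x, xi) = a x + xi v.
Proof.
pose g (x : A) : k^o := f (x, 0).
have gP : linear g.
  move=> c x y; rewrite /g -linearP; congr (f (_, _)).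
  by rewrite /= scaler0 addr0.
pose g' : {linear A -> k^o} := HB.pack g (GRing.isLinear.Build _ _ _ _ g gP).
pose e := vbasis {:V}.
exists (linfun g').
exists (\sum_(i < \dim {:V}) (f (0, dual_basis e i) : k) *: e`_i) => x xi.
have -> : (x, xi) = (x, 0) + (0, xi) :> hatA.
  by congr (_, _); rewrite /= ?addr0 ?add0r.
rewrite linearD lfunE; congr (_ + _).
rewrite {1}[xi]dual_basis_decomp -pair_sumr !linear_sum.
apply: eq_bigr => i _; rewrite linearZ /= [RHS]mulrC.
have -> : (0, (xi e`_i : k) *: dual_basis e i)
         = (xi e`_i : k) *: (0, dual_basis e i) :> hatA.
  by congr (_, _); rewrite /= scaler0.
by rewrite linearZ.
Qed.

Lemma functional_hat (a : dual A) (v : V) :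
  exists f : dual hatA, forall x xi, f (x, xi) = a x + xi v.
Proof.
pose g (p : hatA) : k^o := a p.1 + p.2 v.
have gP : linear g.
  move=> c x y; rewrite /g linearP /= add_lfunE scale_lfunE scalerDr.
  by rewrite addrACA.
pose g' : {linear hatA -> k^o} := HB.pack g (GRing.isLinear.Build _ _ _ _ g gP).
by exists (linfun g') => x xi; rewrite lfunE.
Qed.

(** The right legs of [T] lie in [A] and only see [a], giving the sum of [a (T e_i) e_i^*], which is
    [a \o T]. Those of [sigma T] lie in the dual of [V] and only see [v], giving the sum of
    [e_i^*(v) T e_i], which is [T v]. *)
Lemma contract_hom_tens (T : 'Hom(V, A)) (f : dual hatA) (a : dual A) (v : V) :
  (forall x xi, f (x, xi) = a x + xi v) ->
  contract f (hom_tens T + tswap (hom_tens T)) = (T v, (a \o T)%VF).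
Proof.
move=> fE; pose e := vbasis {:V}.
pose s : seq (hatA * hatA) :=
  [seq ((0, dual_basis e i), (T e`_i, 0)) | i : 'I_(\dim {:V})].
have sE (W : zmodType) (F : hatA * hatA -> W) :
    \sum_(p <- s) F p = \sum_i F ((0, dual_basis e i), (T e`_i, 0)).
  by rewrite big_map big_enum.
have -> : hom_tens T = tsum s by rewrite /tsum sE.
rewrite linearD /= contract_tswap contract_tsum !sE /=.
rewrite addrC [RHS](_ : _ = (T v, 0) + (0, (a \o T)%VF)); last first.
  by congr (_, _); rewrite /= ?addr0 ?add0r.
congr (_ + _).
  rewrite [in RHS](coord_vbasis (memvf v)) linear_sum -pair_suml.
  apply: eq_bigr => i _; rewrite fE linear0 add0r lfunE /= linearZ /=.
  by congr (_, _); rewrite /= scaler0.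
rewrite [X in (_, X)]dual_basis_decomp -pair_sumr.
apply: eq_bigr => i _; rewrite fE zero_lfunE addr0 comp_lfunE.
by congr (_, _); rewrite /= scaler0.
Qed.

End HomTens.

(** * The DYBE in terms of the O-operator defects *)

Section ODefect.
Context {k : fieldType} {A V : vectType k} {D : diass_alg A}.
Variables (M : diass_rep D V) (T : 'Hom(V, A)).
Local Notation hatA := (A * dual V)%type.
Local Notation Dhat := (semidirect (dual_rep M)).
Local Notation r := (hom_tens T + tswap (hom_tens T)).

Definition dashv_defect (u v : V) : A :=
  dashv D (T u) (T v) - T (l_dashv M (T u) v + r_dashv M (T v) u).

Definition vdash_defect (u v : V) : A :=
  vdash D (T u) (T v) - T (l_vdash M (T u) v + r_vdash M (T v) u).

Lemma O_operator_defectP :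
  O_operator M T <-> forall u v, dashv_defect u v = 0 /\ vdash_defect u v = 0.
Proof.
split=> H u v; have [l0 r0] := H u v.
  by rewrite /dashv_defect /vdash_defect l0 r0 !subrr.
by split; apply/subr0_eq.
Qed.

(** Transposition turns every dual action into [a], [b] or [c] applied to [T] of an action on [V].
    For each of [a], [b], [c], the product in [A] comes from one of the three terms and the
    corrections under [T] come from the dual components of the other two. *)
Lemma semidirect_dybe (f g h : dual hatA) (a b c : dual A) (u v w : V)
    (x y z : hatA) :
  (forall x xi, f (x, xi) = a x + xi u) ->
  (forall x xi, g (x, xi) = b x + xi v) ->
  (forall x xi, h (x, xi) = c x + xi w) ->
  x = (T u, (a \o T)%VF) -> y = (T v, (b \o T)%VF) ->
  z = (T w, (c \o T)%VF) ->
  f (vdash Dhat y z) - h (dashv Dhat x y) - g (bullet Dhat z x) =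
  a (vdash_defect v w) - c (dashv_defect u v)
  - b (vdash_defect w u - dashv_defect w u).
Proof.
move=> fE gE hE -> -> ->; rewrite /bullet linearB.
rewrite [vdash Dhat]/= [dashv Dhat]/= /sd_op /= fE hE 2!gE.
rewrite !(dual_mapE, lfun_simp) /= /vdash_defect /dashv_defect.
rewrite ![in RHS](linearB, linearD) /=.
ring.
Qed.

Lemma hom_tens_tsymmetric : tsymmetric r.
Proof. by rewrite /tsymmetric /tswap linearD /= trmxK addrC. Qed.

Lemma dybe_hom_tensP :
  dybe_solution Dhat r <-> forall (a b c : dual A) (u v w : V),
    a (vdash_defect v w) - c (dashv_defect u v)
    - b (vdash_defect w u - dashv_defect w u) = 0.
Proof.
split=> [/(dybe_solution_symP Dhat hom_tens_tsymmetric) sol a b c u v w|H].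
  (* Every triple of pairs is realised by functionals on [hatA]; the converse direction splits given
     functionals into pairs. *)
  have [f fE] := functional_hat a u; have [g gE] := functional_hat b v.
  have [h hE] := functional_hat c w.
  have <- := semidirect_dybe fE gE hE (contract_hom_tens T fE)
    (contract_hom_tens T gE) (contract_hom_tens T hE).
  exact: sol.
apply/(dybe_solution_symP Dhat hom_tens_tsymmetric) => f g h.
have [a [u fE]] := functional_hatE f.
have [b [v gE]] := functional_hatE g.
have [c [w hE]] := functional_hatE h.
have -> := semidirect_dybe fE gE hE (contract_hom_tens T fE)
  (contract_hom_tens T gE) (contract_hom_tens T hE).
exact: H.
Qed.

End ODefect.

Theorem theorem4p5 (k : fieldType) (char0 : [pchar k] =i pred0)
    (A V : vectType k) (D : diass_alg A) (M : diass_rep D V)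
    (T : 'Hom(V, A)) :
  let Dhat : diass_alg (A * dual V)%type := semidirect (dual_rep M) in
  let r : tens (A * dual V)%type (A * dual V)%type :=
    hom_tens T + tswap (hom_tens T) in
  tsymmetric r /\ dybe_solution Dhat r <-> O_operator M T.
Proof.
move=> Dhat r; split=> [[_ /dybe_hom_tensP sol]|/O_operator_defectP TO].
  apply/O_operator_defectP => u v; split; apply: dual_separates => a.
    (* The third slot isolates the defect of [dashv], and the first slot, used next, that of
       [vdash]. The spare vector occurs only under zero functionals, so it is set to [0]. *)
    have := sol 0 0 a u v 0.
    by rewrite !zero_lfunE sub0r subr0 => /eqP; rewrite oppr_eq0 => /eqP.
  by have := sol a 0 0 0 u v; rewrite !zero_lfunE !subr0.
split; first exact: hom_tens_tsymmetric.
apply/dybe_hom_tensP => a b c u v w.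
have [_ ->] := TO v w; have [-> _] := TO u v; have [-> ->] := TO w u.
by rewrite !(linear0, subr0).
Qed.
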